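(* Let $\eta$ be a composition, let $i<j-1$, and let $\lambda^i,\lambda^j$ be compositions of moduli $|\eta|+i$ and $|\eta|+j$. Then $$\binom{\lambda^i}{\lambda^j}_{q,t}=\frac{E_{\lambda^i}^*(\overline{\lambda^j})}{E_{\lambda^j}^*(\overline{\lambda^j})}=\sum_{\substack{\nu\in D_k(\lambda^i)\\ \nu\preceq'\lambda^j}}\frac{\overline{\nu}_k\,\overline{\lambda^i}_k^{-1}-1}{\overline{\lambda^j}_k\,\overline{\lambda^i}_k^{-1}-1}\;\frac{E_{\lambda^i}^*(\overline{\nu})}{E_\nu^*(\overline{\nu})}\;\frac{E^*_\nu(\overline{\lambda^j})}{E^*_{\lambda^j}(\overline{\lambda^j})},$$ where $k$ is the position of the leftmost component of $\lambda^i$ that does not occur with the same frequency in $\lambda^j$ (i.e. the smallest $k$ such that the number of occurrences of the value $\lambda^i_k$ among the components of $\lambda^i$ differs from its number of occurrences among the components of $\lambda^j$).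
   Context: Fix $n\ge1$ and let $q,t$ be independent indeterminates; all polynomials are in $z=(z_1,\dots,z_n)$ with coefficients in $\mathbb{Q}(q,t)$. A composition is $\eta=(\eta_1,\dots,\eta_n)\in\mathbb{N}^n$ ($0\in\mathbb{N}$), with modulus $|\eta|=\sum_i\eta_i$. Put $l'_\eta(i)=\#\{j<i:\eta_j\ge\eta_i\}+\#\{j>i:\eta_j>\eta_i\}$, $\ \overline{\eta}_i=q^{\eta_i}t^{-l'_\eta(i)}$, $\ \overline{\eta}=(\overline{\eta}_1,\dots,\overline{\eta}_n)$. The interpolation Macdonald polynomial $E^*_\eta(z)=E^*_\eta(z;q,t)$ is the unique polynomial of degree $\le|\eta|$ such that $E^*_\eta(\overline{\mu})=0$ for all compositions $\mu\ne\eta$ with $|\mu|\le|\eta|$, and whose coefficient of $z^\eta=z_1^{\eta_1}\cdots z_n^{\eta_n}$ is $1$; it satisfies $E^*_\eta(\overline{\eta})\ne0$. Generalised binomial coefficients: $\binom{\eta}{\nu}_{q,t}:=E^*_\eta(\overline{\nu})/E^*_\nu(\overline{\nu})$. Successor relation: $\eta\preceq'\lambda$ means there is a permutation $\sigma$ of $\{1,\dots,n\}$ such that $\eta_i<\lambda_{\sigma(i)}$ whenever $i<\sigma(i)$ and $\eta_i\le\lambda_{\sigma(i)}$ whenever $i\ge\sigma(i)$. Operators on compositions: $s_i\eta$ swaps the components $\eta_i$ and $\eta_{i+1}$ ($1\le i\le n-1$), and $\Phi\eta=(\eta_2,\dots,\eta_n,\eta_1+1)$. For $1\le k\le n$ and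 a set $I_k\subseteq\{1,\dots,n-1\}$ put $D_{I_k}(\eta)=\sigma_k\cdots\sigma_{n-1}\,\Phi\,\sigma_1\cdots\sigma_{k-1}(\eta)$ (rightmost operator acting first), where $\sigma_j=s_j$ if $j\in I_k$ and $\sigma_j$ is the identity if $j\notin I_k$. Finally $D_k(\lambda^i)=\{\nu:\nu=D_{I_k}(\lambda^i)\text{ for some }I_k\subseteq\{1,\dots,n-1\}\}$.
   Formalization: The formal version also assumes that the denominator (λ^j-bar)_k (λ^i-bar)_k^{-1} − 1 is nonzero; the stated choice of k does not ensure this, e.g. n=2, λ^i=(2,0), λ^j=(2,2), k=1, where both coordinates are q^2. *)

(* Defs.v *)
From HB Require Import structures.
From mathcomp Require Import all_boot all_order all_fingroup all_algebra.
From mathcomp Require Import mpoly.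
From Stdlib Require Import ClassicalEpsilon.

Set Implicit Arguments.
Unset Strict Implicit.
Unset Printing Implicit Defensive.

Import GRing.Theory.
Local Open Scope ring_scope.

(* Compositions of length n are multinomials 'X_{1..n}, with modulus mdeg.
   All positions are counted from 0: position i stands for the mathematical
   position i + 1. *)

(* The field Q(q,t). *)
Definition Qqt : fieldType := {fraction {mpoly rat[2]}}.
Definition q : Qqt := tofrac 'X_(0 : 'I_2).
Definition t : Qqt := tofrac 'X_(1 : 'I_2).

Definition leg' n (eta : 'X_{1..n}) (i : 'I_n) : nat :=
  (#|[set j : 'I_n | (j < i) && (eta i <= eta j)]|
   + #|[set j : 'I_n | (i < j) && (eta i < eta j)]|)%N.

Definition spec n (eta : 'X_{1..n}) (i : 'I_n) : Qqt :=
  q ^+ eta i * t ^- leg' eta i.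

(* As msize p is 1 + the degree of p, the first clause says that p has degree
   at most |eta|. *)
Definition is_interp_macdonald n (eta : 'X_{1..n}) (p : {mpoly Qqt[n]}) : Prop :=
  [/\ (msize p <= (mdeg eta).+1)%N,
      forall mu : 'X_{1..n},
        mu <> eta -> (mdeg mu <= mdeg eta)%N -> p.@[spec mu] = 0
    & p@_eta = 1].

(* There is exactly one polynomial satisfying is_interp_macdonald eta, so this
   is a definite description. *)
Definition Estar n (eta : 'X_{1..n}) : {mpoly Qqt[n]} :=
  epsilon (inhabits 0) (is_interp_macdonald eta).

Definition qtbinom n (eta nu : 'X_{1..n}) : Qqt :=
  (Estar eta).@[spec nu] / (Estar nu).@[spec nu].

Definition preceq' n (eta lambda : 'X_{1..n}) : bool :=
  [exists sigma : 'S_n, [forall i : 'I_n,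
    ((i < sigma i)%N ==> (eta i < lambda (sigma i))%N)
    && ((sigma i <= i)%N ==> (eta i <= lambda (sigma i))%N)]].

(* The indices j : 'I_n.-1 stand for 1, ..., n - 1; as j + 1 < n, the cyclic
   successor ordS of j is j + 1. *)
Definition swap n (j : 'I_n.-1) (eta : 'X_{1..n}) : 'X_{1..n} :=
  let j0 : 'I_n := widen_ord (leq_pred n) j in
  [multinom eta (tperm j0 (ordS j0) i) | i < n].

(* ordS sends the last position to the first one. *)
Definition Phi n (eta : 'X_{1..n}) : 'X_{1..n} :=
  [multinom (eta (ordS i) + (i.+1 == n))%N | i < n].

Definition swap_if n (I : {set 'I_n.-1}) (j : 'I_n.-1) (eta : 'X_{1..n}) :=
  if j \in I then swap j eta else eta.

(* sigma_k ... sigma_(n-1) Phi sigma_1 ... sigma_(k-1), rightmost factor first;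
   enum 'I_n.-1 is increasing, and foldr applies the last index first. *)
Definition D_set n (k : 'I_n) (I : {set 'I_n.-1}) (eta : 'X_{1..n}) :=
  let js := enum 'I_n.-1 in
  foldr (swap_if I)
    (Phi (foldr (swap_if I) eta [seq j : 'I_n.-1 <- js | (j < k)%N]))
    [seq j : 'I_n.-1 <- js | (k <= j)%N].

(* The set D_k(eta), as a duplicate-free sequence. *)
Definition D n (k : 'I_n) (eta : 'X_{1..n}) : seq 'X_{1..n} :=
  undup [seq D_set k J eta | J : {set 'I_n.-1}].

Definition freq n (eta : 'X_{1..n}) (a : nat) : nat :=
  #|[set i : 'I_n | eta i == a]|.

Definition leftmost_freq_diff n (lambda mu : 'X_{1..n}) (k : 'I_n) : Prop :=
  freq lambda (lambda k) <> freq mu (lambda k) /\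
  forall m : 'I_n, (m < k)%N -> freq lambda (lambda m) = freq mu (lambda m).

(* Main.v *)
Require Import Defs.
From HB Require Import structures.
From mathcomp Require Import all_boot all_order all_fingroup all_algebra.
From mathcomp Require Import mpoly zify ring.
From Stdlib Require Import ClassicalEpsilon.

Set Implicit Arguments.
Unset Strict Implicit.
Unset Printing Implicit Defensive.

Import GRing.Theory Num.Theory.
Local Open Scope ring_scope.

(** Write lam for [lami], d for its modulus, E_lam for [Estar lam] and mubar for
    [spec mu]. The whole formula comes from expanding one polynomial,
    (z_k / lambar_k - 1) E_lam, in the interpolation polynomials E_nu: it has
    degree at most d + 1, and it vanishes at mubar for every mu of modulus at most
    d, since E_lam does so for mu <> lam and the first factor does so for
    mu = lam. As a polynomial of degree
    at most d + 1 is determined by its values at the mubar with |mu| <= d + 1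
    ([unisolvence]), only the E_nu with |nu| = d + 1 occur, and the coefficient of
    E_nu is read off at nubar ([Pieri_Estar]). Evaluating at [spec lamj] and dividing
    gives the formula, except that the sum ranges over all such nu. Two
    vanishing statements cut it down: the coefficient is zero unless nu is in
    [D k lam], and E_nu is zero at [spec lamj] unless [preceq' nu lamj].

    Both come from the Hecke algebra. Let H_i and Phi act on polynomials in such a
    way that the value of H_i f at mubar involves only the values of f at mubar
    and at the spectral vector of s_i mu, and that Phi f at the spectral vector of
    Phi mu is a multiple of f at mubar, and zero at the other spectral vectors. Put
    R_k = H_k ... H_(n-1) Phi H_1 ... H_(k-1) ([raising]). If R_k f does not vanish
    at mubar, then mu = [D_set k J mu'] for some J and some mu' at which f does not
    vanish ([raising_spec_neq0]). The key identity is
      R_k E_lam = (z_k / lambar_k - 1) E_lam   ([raising_Estar]).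
    Indeed R_k f + f is divisible by z_k for every f, as on the hyperplane z_k = 0
    all scalars and permutations in R_k cancel up to the sign -1
    ([raising_at0]); the quotient, for f = E_lam, has degree at most d and the
    same values as E_lam / lambar_k at all mubar with |mu| <= d, because
    R_k E_lam vanishes there.

    The identity gives the first vanishing statement at once. For the second one
    ([Estar_vanish]), if lam <> nu and E_nu does not vanish at lambar, choose k with
    lam_k <> nu_k; then R_k E_nu does not vanish at lambar, so lam = [D_set k J mu]
    where E_nu does not vanish at mubar. By induction nu preceq' mu, and
    mu preceq' [D_set k J mu] always holds.

    There remain the unisolvence and the existence of the E_eta. Both say that a
    square matrix over Q(q,t) is invertible. After clearing the powers of t in
    the denominators its entries are polynomials in q and t, so it is enough to
    see that its determinant is nonzero at q = 2, t = 1. There the nodes become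
    the points (2^mu_1, ..., 2^mu_n), for which interpolation is solved by the
    products of the z_i - 2^a with a < nu_i. *)

(** * Degrees and substitutions *)

Section Degree.
Variables (F : fieldType) (n : nat).
Implicit Types (p r : {mpoly F[n]}) (d e : nat).

Definition deg_le d p := (msize p <= d.+1)%N.

Lemma deg_le_leq d e p : (d <= e)%N -> deg_le d p -> deg_le e p.
Proof. by rewrite /deg_le; lia. Qed.

Lemma deg_leC d c : deg_le d c%:MP.
Proof. by rewrite /deg_le msizeC; case: eqP. Qed.

Lemma deg_leX (i : 'I_n) : deg_le 1 'X_i.
Proof. by rewrite /deg_le msizeX mdeg1. Qed.

Lemma deg_leD d p r : deg_le d p -> deg_le d r -> deg_le d (p + r).
Proof.
rewrite /deg_le => hp hr; apply: leq_trans (msizeD_le _ _) _.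
by rewrite geq_max hp.
Qed.

Lemma msizeM_field p r :
  p != 0 -> r != 0 -> msize (p * r) = (msize p + msize r).-1.
Proof. exact: msizeM. Qed.

Lemma deg_leM d e p r : deg_le d p -> deg_le e r -> deg_le (d + e) (p * r).
Proof.
rewrite /deg_le => hp hr; case: (eqVneq p 0) => [->|p0].
  by rewrite mul0r msize0.
case: (eqVneq r 0) => [->|r0]; first by rewrite mulr0 msize0.
by rewrite msizeM_field //; move: p0 r0; rewrite -!msize_poly_eq0; lia.
Qed.

Lemma deg_leZ d c p : deg_le d p -> deg_le d (c *: p).
Proof. by rewrite -mul_mpolyC; apply: (@deg_leM 0); apply: deg_leC. Qed.

Lemma deg_leB d p r : deg_le d p -> deg_le d r -> deg_le d (p - r).
Proof. by move=> hp hr; rewrite -scaleN1r; apply: deg_leD (deg_leZ _ _). Qed.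

Lemma deg_le_sum d (I : Type) (s : seq I) (P : pred I) (G : I -> {mpoly F[n]}) :
  (forall i, P i -> deg_le d (G i)) -> deg_le d (\sum_(i <- s | P i) G i).
Proof.
move=> hG; apply: (big_ind (deg_le d)) => //; first exact: deg_leC.
exact: deg_leD.
Qed.

Lemma deg_le_prod (I : Type) (s : seq I) (e : I -> nat) (G : I -> {mpoly F[n]}) :
  (forall i, deg_le (e i) (G i)) ->
  deg_le (\sum_(i <- s) e i) (\prod_(i <- s) G i).
Proof.
move=> hG; apply: (big_ind2 (fun d p => deg_le d p)) => //; first exact: deg_leC.
by move=> ? ? ? ? ? ?; apply: deg_leM.
Qed.

Lemma deg_le_exp d m p : deg_le d p -> deg_le (m * d) (p ^+ m).
Proof.
move=> hp; elim: m => [|m IH]; first exact: deg_leC.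
by rewrite exprS mulSn; apply: deg_leM.
Qed.

(** Over a domain degrees add, so dividing by a non-constant polynomial
    lowers the degree. *)
Lemma deg_le_divr d p r :
  (1 < msize p)%N -> deg_le d.+1 (p * r) -> deg_le d r.
Proof.
case: (eqVneq r 0) => [->|r0 p1]; first by rewrite /deg_le msize0.
have p0 : p != 0 by rewrite -msize_poly_eq0; case: (msize p) p1.
by rewrite /deg_le msizeM_field //; move: r0; rewrite -msize_poly_eq0; lia.
Qed.

End Degree.

Section Substitution.
Variables (F : fieldType) (n : nat).
Implicit Types (p r : {mpoly F[n]}) (lq : n.-tuple {mpoly F[n]}).

Lemma deg_le_comp d p lq :
  (forall i, deg_le 1 (tnth lq i)) -> deg_le d p -> deg_le d (p \mPo lq).
Proof.
move=> hlq hp; rewrite comp_mpolyE big_seq; apply: deg_le_sum => m hm.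
apply: deg_leZ; apply: (@deg_le_leq _ _ (mdeg m) d).
  by have := msize_mdeg_lt hm; move: hp; rewrite /deg_le; lia.
rewrite mdegE; apply: deg_le_prod => i.
by have := deg_le_exp (m i) (hlq i); rewrite muln1.
Qed.

(** If a substitution moves each variable by a multiple of [r], it moves each
    polynomial by a multiple of [r]; this gives both the divided differences and
    the divisibility by a variable. *)
Lemma dvd_sub_comp r lq :
  (forall i, exists g, 'X_i - tnth lq i = r * g) ->
  forall p, exists g, p - (p \mPo lq) = r * g.
Proof.
move=> hX.
have hmul p1 p2 : (exists g, p1 - (p1 \mPo lq) = r * g) ->
    (exists g, p2 - (p2 \mPo lq) = r * g) ->
    exists g, p1 * p2 - ((p1 * p2) \mPo lq) = r * g.
  move=> [g1 h1] [g2 h2]; exists (g1 * p2 + (p1 \mPo lq) * g2).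
  by rewrite rmorphM mulrDr mulrA -h1 mulrCA -h2 /=; ring.
elim/mpolyind => [|c m p _ _ [g hg]].
  by exists 0; rewrite raddf0 subr0 mulr0.
have [g' hg'] : exists g', 'X_[m] - ('X_[m] \mPo lq) = r * g'.
  rewrite mpolyXE_id.
  elim/big_ind: _ => [||i _]; first by exists 0; rewrite rmorph1 subrr mulr0.
    exact: hmul.
  elim: (m i) => [|e IH]; first by exists 0; rewrite rmorph1 subrr mulr0.
  rewrite exprS; apply: hmul IH.
  by rewrite comp_mpolyXU -tnth_nth.
exists (c *: g' + g).
by rewrite raddfD /= comp_mpolyZ mulrDr -scalerAr -hg -hg' scalerBr; ring.
Qed.

End Substitution.

(** * Hecke operators on polynomials *)

(* lia does not split conditionals; the innermost conditions go first. *)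
Ltac case_ifs :=
  repeat match goal with |- context [if ?b then _ else _] =>
    lazymatch b with
    | context [if _ then _ else _] => fail
    | _ => let h := fresh in case h : b
    end
  end; lia.

Section Positions.
Variable n : nat.
Implicit Type j : 'I_n.+1.-1.

Definition lpos j : 'I_n.+1 := widen_ord (leq_pred n.+1) j.

Lemma val_ordS_lpos j : ordS (lpos j) = j.+1 :> nat.
Proof. by rewrite /= modn_small // ltnS; exact: (ltn_ord j). Qed.

Lemma lpos_neq j : lpos j != ordS (lpos j).
Proof. by apply/eqP => /(congr1 (@nat_of_ord _)); rewrite val_ordS_lpos /=; lia. Qed.

Lemma val_ord_pred0 : ord_pred (@ord0 n) = n :> nat.
Proof. by rewrite /= modn_small. Qed.

Lemma val_ord_predS (i : 'I_n.+1) : i != ord0 -> ord_pred i = i.-1 :> nat.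
Proof.
case: i => [[|m] hm] //= _.
by rewrite modnDr modn_small // ltnW.
Qed.

Definition adj_tperm j : 'S_n.+1 := tperm (lpos j) (ordS (lpos j)).

Lemma val_adj_tperm j (i : 'I_n.+1) :
  nat_of_ord (adj_tperm j i) =
  (if i == j :> nat then j.+1 else if i == j.+1 :> nat then nat_of_ord j else i).
Proof.
have hr := val_ordS_lpos j.
rewrite /adj_tperm; case: tpermP => [->|->|h1 h2]; rewrite ?hr ?eqxx //.
  by case: eqP => //; lia.
have /eqP/negPf -> : (i : nat) <> j by move=> e; apply: h1; apply: val_inj.
have /eqP/negPf -> // : (i : nat) <> j.+1.
by move=> e; apply: h2; apply: val_inj; exact: etrans e (esym hr).
Qed.

End Positions.

Section Operators.
Variables (F : fieldType) (q t : F) (n : nat).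
Implicit Types (p r : {mpoly F[n.+1]}) (j : 'I_n.+1.-1) (v : 'I_n.+1 -> F).

Definition swap_poly j p := p \mPo [tuple 'X_(adj_tperm j i) | i < n.+1].

Lemma swap_polyE j p v : (swap_poly j p).@[v] = p.@[fun i => v (adj_tperm j i)].
Proof.
rewrite comp_mpoly_meval; apply: meval_eq => i.
by rewrite tnth_mktuple mevalXU.
Qed.

Lemma ddiff_ex j p :
  exists g, p - swap_poly j p == ('X_(lpos j) - 'X_(ordS (lpos j))) * g.
Proof.
have [i|g hg] := @dvd_sub_comp F n.+1 ('X_(lpos j) - 'X_(ordS (lpos j)))
  [tuple 'X_(adj_tperm j i) | i < n.+1] _ p; last by exists g; apply/eqP.
rewrite tnth_mktuple /adj_tperm; case: tpermP => [->|->|_ _].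
- by exists 1; rewrite mulr1.
- by exists (-1); rewrite mulrN1 opprB.
- by exists 0; rewrite subrr mulr0.
Qed.

(** The divided difference (p - s_j p) / (z_j - z_(j+1)). *)
Definition ddiff j p := xchoose (ddiff_ex j p).

Lemma ddiffE j p :
  p - swap_poly j p = ('X_(lpos j) - 'X_(ordS (lpos j))) * ddiff j p.
Proof. exact/eqP/(xchooseP (ddiff_ex j p)). Qed.

(** A Demazure-Lusztig operator. With z_j, and not z_(j+1), in front of the divided
    difference it becomes t s_j on the hyperplane z_j = 0, on which
    [foldr_Hecke_at0] depends. *)
Definition Hecke j p := t *: swap_poly j p + (t - 1) *: ('X_(lpos j) * ddiff j p).

Lemma Hecke_meval j p v :
  (Hecke j p).@[v] = t * p.@[fun i => v (adj_tperm j i)]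
                     + (t - 1) * (v (lpos j) * (ddiff j p).@[v]).
Proof. by rewrite mevalD !mevalZ swap_polyE mevalM mevalXU. Qed.

(** The coefficient of the permuted value vanishes when v_j = t v_(j+1). For a
    spectral vector this happens when entries j and j + 1 of the composition are
    equal, which is when permuting it does not give a spectral vector. *)
Lemma Hecke_interp j p v :
  (v (lpos j) - v (ordS (lpos j))) * (Hecke j p).@[v]
  = (v (lpos j) - t * v (ordS (lpos j))) * p.@[fun i => v (adj_tperm j i)]
    + (t - 1) * v (lpos j) * p.@[v].
Proof.
rewrite Hecke_meval; have := congr1 (meval v) (ddiffE j p).
rewrite mevalB mevalM mevalB !mevalXU swap_polyE => /eqP.
rewrite subr_eq => /eqP ->; ring.
Qed.

Lemma deg_le_swap_poly d j p : deg_le d p -> deg_le d (swap_poly j p).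
Proof. by apply: deg_le_comp => i; rewrite tnth_mktuple; apply: deg_leX. Qed.

Lemma deg_le_Hecke d j p : deg_le d p -> deg_le d (Hecke j p).
Proof.
move=> hp; apply: deg_leD; apply: deg_leZ; first exact: deg_le_swap_poly.
case: d hp => [|d] hp.
  have [c ->] : exists c, p = c%:MP.
    by move: hp; rewrite /deg_le; exists p@_0; apply: msize1_polyC.
  suff -> : ddiff j c%:MP = 0 by rewrite mulr0; apply: deg_leC.
  have /eqP := ddiffE j c%:MP.
  rewrite /swap_poly comp_mpolyC subrr eq_sym mulf_eq0 subr_eq0.
  case/orP => /eqP // /(congr1 (mcoeff U_(lpos j))) /eqP.
  by rewrite !mcoeffXU eqxx [ordS _ == _]eq_sym (negPf (lpos_neq j)) oner_eq0.
apply: (@deg_leM _ _ 1 d); first exact: deg_leX.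
apply: (deg_le_divr (p := 'X_(lpos j) - 'X_(ordS (lpos j)))); last first.
  by rewrite -ddiffE; apply: deg_leB => //; apply: deg_le_swap_poly.
have : U_(lpos j)%MM \in msupp ('X_(lpos j) - 'X_(ordS (lpos j)) : {mpoly F[n.+1]}).
  rewrite mcoeff_msupp mcoeffB !mcoeffXU eqxx [ordS _ == _]eq_sym.
  rewrite (negPf (lpos_neq j)) subr0.
  exact: oner_neq0.
by move/msize_mdeg_lt; rewrite mdeg1.
Qed.

Definition rot_poly p :=
  p \mPo [tuple (if i == ord0 then q^-1 else 1) *: 'X_(ord_pred i) | i < n.+1].

(** The linear factor vanishes at the spectral vectors of the compositions
    whose last entry is zero, that is, those outside the image of [Phi]
    ([spec_last0], [Phi_surj]). *)
Definition Phi_poly p := ('X_ord_max - (t ^- n)%:MP) * rot_poly p.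

Lemma Phi_poly_meval p v :
  (Phi_poly p).@[v] = (v ord_max - t ^- n)
    * p.@[fun i => (if i == ord0 then q^-1 else 1) * v (ord_pred i)].
Proof.
rewrite mevalM mevalB mevalXU mevalC comp_mpoly_meval; congr (_ * _).
by apply: meval_eq => i; rewrite tnth_mktuple mevalZ mevalXU.
Qed.

Lemma deg_le_Phi_poly d p : deg_le d p -> deg_le d.+1 (Phi_poly p).
Proof.
move=> hp; apply: (@deg_leM _ _ 1 d).
  by apply: deg_leB; [apply: deg_leX|apply: deg_le_leq (@deg_leC _ _ 0 _)].
apply: deg_le_comp => // i; rewrite tnth_mktuple; apply: deg_leZ; exact: deg_leX.
Qed.

(** These are the two words in [D_set], so that [raising] can be compared with
    [D_set] factor by factor. *)
Definition below (k : 'I_n.+1) := [seq j : 'I_n.+1.-1 <- enum 'I_n.+1.-1 | (j < k)%N].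
Definition above (k : 'I_n.+1) := [seq j : 'I_n.+1.-1 <- enum 'I_n.+1.-1 | (k <= j)%N].

Lemma val_below k : map val (below k) = iota 0 k.
Proof.
rewrite -[below k]/(filter (preim val (fun i => i < k)%N) _) -filter_map val_enum_ord.
by rewrite (@filter_iota_ltn 0) // -ltnS.
Qed.

Lemma val_above k : map val (above k) = iota k (n - k).
Proof.
rewrite -[above k]/(filter (preim val (fun i => k <= i)%N) _) -filter_map.
rewrite val_enum_ord /=.
have hk : (k <= n)%N by rewrite -ltnS.
have -> : iota 0 n = iota 0 k ++ iota k (n - k).
  by have := iotaD 0 k (n - k); rewrite subnKC.
rewrite filter_cat.
rewrite (eq_in_filter (a2 := pred0)) ?filter_pred0; last first.
  by move=> i; rewrite mem_iota /=; lia.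
rewrite (eq_in_filter (a2 := predT)) ?filter_predT // => i.
by rewrite mem_iota /=; lia.
Qed.

(** This is z_k Xi_k - 1, where the Xi_k are the Cherednik operators whose joint
    eigenfunctions are the interpolation Macdonald polynomials. *)
Definition raising k p := foldr Hecke (Phi_poly (foldr Hecke p (below k))) (above k).

Lemma deg_le_foldr_Hecke d js p : deg_le d p -> deg_le d (foldr Hecke p js).
Proof. by move=> hp; elim: js => //= j js IH; apply: deg_le_Hecke. Qed.

Lemma deg_le_raising d k p : deg_le d p -> deg_le d.+1 (raising k p).
Proof.
move=> hp; apply: deg_le_foldr_Hecke; apply: deg_le_Phi_poly.
exact: deg_le_foldr_Hecke.
Qed.

(** The product of the transpositions at m, ..., m + l - 1, as a map on positions:
    it reads coordinate m at position m + l. *)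
Definition rotate_from m l i : nat :=
  if (i < m)%N then i else if (i < m + l)%N then i.+1
  else if i == (m + l)%N then m else i.

(** Where coordinate m is zero, H_m only permutes and multiplies by t. The
    permutation moves the zero to coordinate m + 1, where the next factor
    H_(m+1) needs it. *)
Lemma foldr_Hecke_at0 js m l p (V : nat -> F) :
  map val js = iota m l -> V m = 0 ->
  (foldr Hecke p js).@[fun i => V i] = t ^+ l * p.@[fun i => V (rotate_from m l i)].
Proof.
elim: js m l V => [|j js IH] m [|l] V //=.
  move=> _ _; rewrite expr0 mul1r; apply: meval_eq => i; congr V.
  by rewrite /rotate_from; case_ifs.
move=> [hj hjs] Vm.
rewrite Hecke_meval /= hj Vm mul0r mulr0 addr0 exprS -mulrA.
pose W i := V (if i == m then m.+1 else if i == m.+1 then m else i).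
have -> : (foldr Hecke p js).@[fun i => V (adj_tperm j i)]
    = (foldr Hecke p js).@[fun i => W i].
  by apply: meval_eq => i; rewrite /W val_adj_tperm hj.
rewrite (IH m.+1 l) //; last first.
  by rewrite /W eqxx; case: eqP => //; lia.
congr (_ * (_ * _)); apply: meval_eq => i; rewrite /W /rotate_from; congr V.
by case_ifs.
Qed.

Hypothesis t0 : t != 0.

(** The words above and below k contribute t^(n-k) and t^k in the n + 1 variables
    (k counted from 0), and the linear factor of [Phi_poly] contributes -t^(-n).
    The zero coordinate travels from k to the last position, then to the first
    one and back to k, so the permutations compose to the identity. The factor
    1/q only multiplies this zero coordinate. *)
Lemma raising_at0 (k : 'I_n.+1) p v : v k = 0 -> (raising k p).@[v] = - p.@[v].
Proof.
move=> vk; pose V i := v (inord i).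
have -> r : r.@[v] = r.@[fun i => V i].
  by apply: meval_eq => i; rewrite /V inord_val.
have Vk : V k = 0 by rewrite /V inord_val.
have hk : (k <= n)%N by rewrite -ltnS.
rewrite /raising (foldr_Hecke_at0 _ (val_above k)) // Phi_poly_meval.
rewrite {1}/rotate_from /= subnKC // ltnNge hk ltnn eqxx Vk sub0r.
pose W i := if i == 0%N then 0 else V (rotate_from k (n - k) i.-1).
have -> : (foldr Hecke p (below k)).@[fun i : 'I_n.+1 =>
      (if i == ord0 then q^-1 else 1) * V (rotate_from k (n - k) (ord_pred i))]
    = (foldr Hecke p (below k)).@[fun i => W i].
  apply: meval_eq => i; rewrite /W; case: (eqVneq i ord0) => [->|i0].
    by rewrite val_ord_pred0 /rotate_from subnKC // ltnNge hk ltnn eqxx Vk mulr0.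
  by rewrite mul1r val_ord_predS // -[_ == _](_ : (i == ord0) = _) // (negPf i0).
rewrite (foldr_Hecke_at0 _ (val_below k)) //.
have -> : p.@[fun i : 'I_n.+1 => W (rotate_from 0 k i)] = p.@[fun i => V i].
  apply: meval_eq => i; rewrite /W /rotate_from /= add0n.
  have := ltn_ord i => hi.
  case: ltngtP => [ik|ik|ik] /=.
  - by rewrite ik.
  - have -> : (i == 0 :> nat) = false by lia.
    congr V; case_ifs.
  - by rewrite ik Vk.
have key : t ^+ (n - k) * (t ^- n * t ^+ k) = 1.
  by rewrite mulrCA -exprD subnK // mulVf // expf_neq0.
rewrite !mulNr mulrN; congr (- _).
rewrite [t ^- n * _]mulrA mulrA key mul1r.
by apply: meval_eq => i; rewrite /V inord_val.
Qed.

End Operators.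

(** * Interpolation at the nodes 2^mu, and its lift to spectral vectors *)

Section Newton.
Variable n : nat.
Implicit Types (nu mu : 'X_{1..n}).

Definition newton_line (i : 'I_n) (m : nat) : {mpoly rat[n]} :=
  \prod_(a < m) ('X_i - (2 ^+ a)%:MP).

(** Newton's basis for the grid of the nodes (2^mu_1, ..., 2^mu_n). *)
Definition newton nu : {mpoly rat[n]} := \prod_i newton_line i (nu i).

Definition node mu (i : 'I_n) : rat := 2 ^+ mu i.

Lemma deg_le_newton_line i m : deg_le m (newton_line i m).
Proof.
rewrite -[X in deg_le X _](card_ord m) -sum1_card; apply: deg_le_prod => a.
by apply: deg_leB; [apply: deg_leX | apply: deg_le_leq (@deg_leC _ _ 0 _)].
Qed.

Lemma deg_le_newton nu : deg_le (mdeg nu) (newton nu).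
Proof.
rewrite mdegE; apply: deg_le_prod => i.
exact: deg_le_newton_line.
Qed.

Lemma newton_eval nu mu :
  (newton nu).@[node mu] = \prod_i \prod_(a < nu i) (2 ^+ mu i - 2 ^+ a).
Proof.
rewrite rmorph_prod; apply: eq_bigr => i _; rewrite rmorph_prod.
by apply: eq_bigr => a _; rewrite /= mevalB mevalXU mevalC.
Qed.

(** If mu_i < nu_i for some i, the factor z_i - 2^mu_i is present and vanishes. *)
Lemma newton_eval_neq0 nu mu :
  ((newton nu).@[node mu] != 0) = [forall i, nu i <= mu i]%N.
Proof.
have pow2 a b : (2 ^+ a - 2 ^+ b != 0 :> rat) = (a != b).
  by rewrite subr_eq0 -!natrX eqr_nat eqn_exp2l.
rewrite newton_eval; apply/idP/forallP => [/prodf_neq0 h i|h].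
  have /prodf_neq0 hi := h i isT.
  rewrite leqNgt; apply/negP => lt.
  by have := hi (Ordinal lt) isT; rewrite pow2 eqxx.
apply/prodf_neq0 => i _; apply/prodf_neq0 => a _; rewrite pow2.
by have := h i; have := ltn_ord a; lia.
Qed.

(** Triangularity of the Newton basis: nu <= mu entrywise and
    |mu| <= |nu| force mu = nu. *)
Lemma newton_eval_deg nu mu : (mdeg mu <= mdeg nu)%N ->
  ((newton nu).@[node mu] != 0) = (mu == nu).
Proof.
move=> le; rewrite newton_eval_neq0; apply/forallP/eqP => [h|-> //].
have : mdeg mu == mdeg nu.
  by rewrite eqn_leq le !mdegE; apply: leq_sum => i _.
move=> /eqP e; apply/mnmP => i; apply/eqP; rewrite eq_sym.
have : [forall i, nu i == mu i].
  have := leqif_sum (fun i (_ : true) => leqif_eq (h i)).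
  by rewrite -!mdegE e => -[_]; rewrite eqxx => /esym.
by move/forallP.
Qed.

Lemma mcoeff_sub_mul (p : {mpoly rat[n]}) (i : 'I_n) c m :
  deg_le (mdeg m) p -> (('X_i - c%:MP) * p)@_(U_(i) + m) = p@_m.
Proof.
move=> hp; rewrite mulrBl mcoeffB mulrC mcoeffMX mcoeffCM.
rewrite [X in _ * X](_ : _ = 0) ?mulr0 ?subr0 //.
by apply: memN_msupp_eq0; apply: msize_mdeg_ge; rewrite mdegD mdeg1 add1n.
Qed.

End Newton.

(** The coefficient of the top monomial is followed through the product one
    linear factor at a time; the constants do not reach it for degree reasons. *)
Lemma mcoeff_newton n (nu : 'X_{1..n}) : (newton nu)@_nu = 1.
Proof.
have line i m (p : {mpoly rat[n]}) mu : deg_le (mdeg mu) p ->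
    (newton_line i m * p)@_(U_(i) *+ m + mu) = p@_mu.
  move=> hp; elim: m => [|m IH].
    by rewrite /newton_line big_ord0 mul1r mulm0n add0m.
  rewrite /newton_line big_ord_recr /= (mulrC (\prod_(a < m) _)) -mulrA.
  rewrite mulmS -addmA mcoeff_sub_mul ?IH //.
  rewrite mdegD mdegMn mdeg1 mul1n; apply: deg_leM => //.
  exact: deg_le_newton_line.
rewrite [X in _@_X](multinomUE_id nu) /newton.
have [] // : deg_le (mdeg (\sum_(i < n) U_(i) *+ nu i)%MM)
     (\prod_(i < n) newton_line i (nu i))
  /\ (\prod_(i < n) newton_line i (nu i))@_(\sum_(i < n) U_(i) *+ nu i)%MM = 1.
rewrite /index_enum; elim: (Finite.enum _) => [|i s [IH1 IH2]].
  by rewrite !big_nil mcoeff1 eqxx; split=> //; apply: deg_leC.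
rewrite !big_cons line //; split=> //.
by rewrite mdegD mdegMn mdeg1 mul1n; apply: deg_leM => //; apply: deg_le_newton_line.
Qed.

Section Functionals.
Variable n : nat.
Implicit Types (o : option 'X_{1..n}) (mu nu eta : 'X_{1..n}).

(** The condition attached to mu in an interpolation problem at the points x.
    For [o = None] all conditions prescribe values, which gives unisolvence; for
    [o = Some eta] the condition at eta prescribes the coefficient of z^eta
    instead, which gives the existence of the normalised polynomial E_eta. Both
    problems are solved by the same argument. *)
Definition interp_functional (F : fieldType) (x : 'X_{1..n} -> 'I_n -> F) o mu
  (p : {mpoly F[n]}) : F := if o == Some mu then p@_mu else p.@[x mu].

Lemma interp_functional_sum (F : fieldType) (x : 'X_{1..n} -> 'I_n -> F) o mu
    (I : finType) (c : I -> F) (p : I -> {mpoly F[n]}) :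
  interp_functional x o mu (\sum_a c a *: p a)
  = \sum_a c a * interp_functional x o mu (p a).
Proof.
rewrite /interp_functional; case: ifP => _; rewrite raddf_sum; apply: eq_bigr => a _ /=.
  by rewrite mcoeffZ.
by rewrite mevalZ.
Qed.

Variable d : nat.
Local Notation B := 'X_{1..n < d.+1}.

(** A linear relation between the conditions is tested on Newton polynomials. The
    one of eta vanishes at all nodes but that of eta, since |eta| = d, and its
    coefficient of z^eta is 1; so the condition at eta does not occur in the
    relation. Then take mu of largest modulus among those with a nonzero
    coefficient: by triangularity its Newton polynomial kills all other terms. *)
Lemma node_functionals_free o (v : B -> rat) :
  (forall eta, o = Some eta -> mdeg eta = d) ->
  (forall nu : B, \sum_(mu : B) v mu * interp_functional (@node n) o mu 'X_[nu] = 0) ->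
  forall mu : B, v mu = 0.
Proof.
move=> ho hv.
have hB (mu : B) : (mdeg mu <= d)%N by rewrite -ltnS bmdeg.
have kill (p : {mpoly rat[n]}) : deg_le d p ->
    \sum_(mu : B) v mu * interp_functional (@node n) o mu p = 0.
  move=> hp; rewrite (mpolywE hp).
  under eq_bigr do rewrite interp_functional_sum mulr_sumr.
  rewrite exchange_big big1 // => nu _.
  under eq_bigr do rewrite mulrCA.
  by rewrite -mulr_sumr hv mulr0.
have v_eta (mu0 : B) : o = Some (mu0 : 'X_{1..n}) -> v mu0 = 0.
  move=> e; have dm := ho _ e.
  have hN := deg_le_newton mu0; rewrite dm in hN; have := kill _ hN.
  rewrite (bigD1 mu0) //= big1 ?addr0.
    by rewrite /interp_functional e eqxx mcoeff_newton mulr1.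
  move=> mu hmu; rewrite /interp_functional e.
  rewrite (inj_eq Some_inj) [_ == _](negPf _); last by rewrite eq_sym; exact: hmu.
  apply/eqP; rewrite mulf_eq0; apply/orP; right; apply/negPn.
  by rewrite newton_eval_deg ?(negPf hmu) // dm.
move=> mu0; apply/eqP/negPn/negP => nz.
case: (@arg_maxnP B mu0 (fun mu : B => v mu != 0) (fun mu : B => mdeg mu) nz)
  => mu1 nz1 hmax.
have := kill (newton mu1) (deg_le_leq (hB mu1) (deg_le_newton _)).
rewrite (bigD1 mu1) //= big1 ?addr0.
  have o1 : (o == Some (mu1 : 'X_{1..n})) = false.
    by apply/eqP => /v_eta /eqP; rewrite (negPf nz1).
  rewrite /interp_functional o1 => /eqP; rewrite mulf_eq0 (negPf nz1) /=.
  by apply/negP; rewrite newton_eval_deg.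
move=> mu hmu; apply/eqP; rewrite mulf_eq0; case: eqP => //= /eqP nz2.
have o2 : (o == Some (mu : 'X_{1..n})) = false.
  by apply/eqP => /v_eta /eqP; rewrite (negPf nz2).
rewrite /interp_functional o2; apply/negPn.
by rewrite newton_eval_deg ?(negPf hmu) //; apply: hmax.
Qed.

(** The two sets counted in a leg are disjoint. *)
Lemma leg'_leq mu (i : 'I_n) : (leg' mu i <= n)%N.
Proof.
rewrite /leg' -[X in (_ <= X)%N](card_ord n) -cardsT -cardsUI.
set A := (X in (#|X :|: _| + _)%N); set C := (X in (#|_ :|: X| + _)%N).
have -> : A :&: C = set0.
  by apply/setP => j; rewrite /A /C !inE; case: ltngtP => // _; rewrite ?andbF.
by rewrite cards0 addn0 subset_leq_card // subsetT.
Qed.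

Definition interp_scale o mu : Qqt := if o == Some mu then 1 else t ^+ (n * d).

(** The condition at mu applied to z^nu at the spectral vectors, multiplied by
    t^(n d) to make it a polynomial in q = 'X_0 and t = 'X_1. *)
Definition interp_entry o mu nu : {mpoly rat[2]} :=
  if o == Some mu then (nu == mu)%:R
  else 'X_0 ^+ (\sum_i mu i * nu i) * 'X_1 ^+ (n * d - \sum_i leg' mu i * nu i).

Lemma t_neq0 : t != 0.
Proof.
rewrite tofrac_eq0; apply/eqP => /(congr1 (meval (fun _ => 1))).
by rewrite mevalXU meval0.
Qed.

Lemma interp_entryE o mu nu : (mdeg nu <= d)%N ->
  tofrac (interp_entry o mu nu)
  = interp_scale o mu * interp_functional (@spec n) o mu 'X_[nu].
Proof.
rewrite /interp_entry /interp_scale /interp_functional => hd; case: ifP => _.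
  by rewrite mul1r mcoeffX rmorph_nat.
have le : (\sum_i leg' mu i * nu i <= n * d)%N.
  apply: (@leq_trans (\sum_i n * nu i)).
    by apply: leq_sum => i _; rewrite leq_mul2r leg'_leq orbT.
  by rewrite -big_distrr /= leq_mul2l -mdegE hd orbT.
rewrite rmorphM !rmorphXn /= -/q -/t mevalX.
have -> : \prod_(i < n) spec mu i ^+ nu i
    = q ^+ (\sum_i mu i * nu i) * t ^- (\sum_i leg' mu i * nu i).
  rewrite -exprVn !expr_sum -big_split; apply: eq_bigr => i _.
  by rewrite /spec exprMn -exprVn -!exprM.
rewrite mulrCA; congr (_ * _).
by rewrite -[in RHS](subnK le) exprD mulfK // expf_neq0 // t_neq0.
Qed.

Definition interp_mx o : 'M[{mpoly rat[2]}]_#|{: B}| :=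
  \matrix_(a, b) interp_entry o (enum_val a : B) (enum_val b : B).

Definition q2_t1 (i : 'I_2) : rat := if i == 0 then 2 else 1.

Lemma interp_entry_specialized o mu nu :
  (interp_entry o mu nu).@[q2_t1] = interp_functional (@node n) o mu 'X_[nu].
Proof.
rewrite /interp_entry /interp_functional; case: ifP => _.
  by rewrite mcoeffX rmorph_nat.
rewrite rmorphM !rmorphXn /= !mevalXU /q2_t1 /= expr1n mulr1 mevalX.
by rewrite expr_sum; apply: eq_bigr => i _; rewrite /node exprM.
Qed.

(** The determinant is a polynomial in q and t, and it is nonzero at q = 2 and
    t = 1, where the spectral vector of mu becomes the node 2^mu. *)
Lemma interp_mx_unit o : (forall eta, o = Some eta -> mdeg eta = d) ->
  map_mx (@tofrac _) (interp_mx o) \in unitmx.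
Proof.
move=> ho.
have : map_mx (meval q2_t1) (interp_mx o) \in unitmx.
  rewrite -row_free_unit; apply: inj_row_free => v hv.
  pose w (mu : B) := v 0 (enum_rank mu).
  have w0 : forall mu : B, w mu = 0.
    apply: (node_functionals_free ho) => nu.
    have := congr1 (fun A : 'rV_#|{: B}| => A 0 (enum_rank nu)) hv.
    rewrite !mxE => {2}<-.
    rewrite (reindex enum_rank) /=; last by apply: onW_bij; apply: enum_rank_bij.
    apply: eq_bigr => mu _; rewrite !mxE !enum_rankK.
    by rewrite interp_entry_specialized.
  by apply/rowP => a; rewrite mxE -(enum_valK a); apply: w0.
rewrite !unitmxE !det_map_mx !unitfE; apply: contraNneq => /eqP.
by rewrite tofrac_eq0 => /eqP ->; rewrite rmorph0.
Qed.

End Functionals.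

(** * Spectral vectors of compositions *)

Lemma q_neq0 : q != 0.
Proof.
rewrite tofrac_eq0; apply/eqP => /(congr1 (meval (fun _ => 1))).
by rewrite mevalXU meval0.
Qed.

Lemma t_neq1 : t != 1.
Proof.
rewrite -(rmorph1 (@tofrac {mpoly rat[2]})) tofrac_eq.
by apply/eqP => /(congr1 (meval (fun _ => 0))); rewrite mevalXU meval1.
Qed.

Lemma spec_neq0 n (eta : 'X_{1..n}) i : spec eta i != 0.
Proof.
rewrite /spec; apply: mulf_neq0; first exact: expf_neq0 q_neq0.
by apply: invr_neq0; apply: expf_neq0 t_neq0.
Qed.

(** A coordinate of a spectral vector determines the entry, as the power of q
    in q^a t^(-b). *)
Lemma spec_inj n (eta mu : 'X_{1..n}) i j : spec eta i = spec mu j -> eta i = mu j.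
Proof.
rewrite /spec => e.
have : q ^+ eta i * t ^+ leg' mu j = q ^+ mu j * t ^+ leg' eta i.
  have h m : t ^+ m != 0 by rewrite expf_neq0 // t_neq0.
  by apply/eqP; rewrite -eqr_div // e.
rewrite /q /t -!rmorphXn -!rmorphM /= => /eqP.
rewrite tofrac_eq => /eqP /(congr1 (meval q2_t1)).
rewrite !rmorphM !rmorphXn /= !mevalXU /q2_t1 /= !expr1n !mulr1 => /eqP.
by rewrite -!natrX eqr_nat eqn_exp2l // => /eqP.
Qed.

Section Compositions.
Variable n : nat.
Implicit Types (eta lam mu nu : 'X_{1..n.+1}) (j : 'I_n.+1.-1).

(** One sum over all positions, so that it can be reindexed by a bijection. *)
Lemma leg'E eta i :
  leg' eta i = (\sum_(a < n.+1) (if a < i then eta i <= eta a else eta i < eta a))%N.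
Proof.
have card (P : pred 'I_n.+1) : #|[set a | P a]| = (\sum_a P a)%N.
  by rewrite -sum1dep_card big_mkcond.
rewrite /leg' !card -big_split; apply: eq_bigr => a _ /=.
by case: ltngtP => //= [_|/val_inj ->]; rewrite ?addn0 ?ltnn.
Qed.

Lemma swapE j eta i : swap j eta i = eta (adj_tperm j i).
Proof. by rewrite mnmE. Qed.

Lemma swapK j : involutive (@swap n.+1 j).
Proof. by move=> eta; apply/mnmP => i; rewrite !swapE /adj_tperm tpermK. Qed.

Lemma mdeg_swap j eta : mdeg (swap j eta) = mdeg eta.
Proof.
rewrite !mdegE [RHS](reindex_inj (@perm_inj _ (adj_tperm j))).
by apply: eq_bigr => i _; rewrite swapE.
Qed.

(** The swap changes the relative order of positions j and j + 1 only, and for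
    distinct entries the weak and the strict comparison agree. *)
Lemma leg'_swap j eta i : eta (lpos j) != eta (ordS (lpos j)) ->
  leg' (swap j eta) i = leg' eta (adj_tperm j i).
Proof.
move=> ne; rewrite !leg'E [RHS](reindex_inj (@perm_inj _ (adj_tperm j))).
apply: eq_bigr => a _; rewrite !swapE.
case: (boolP ((a < i)%N == (adj_tperm j a < adj_tperm j i)%N)) => [/eqP -> //|].
rewrite !val_adj_tperm => h.
suff /negPf ne' : eta (adj_tperm j i) != eta (adj_tperm j a).
  by rewrite [(_ <= eta _)%N]leq_eqVlt ne' /= !if_same.
have [[hi ha]|[hi ha]] : (i = j :> nat /\ a = j.+1 :> nat) \/
    (i = j.+1 :> nat /\ a = j :> nat).
  by move: h; case_ifs.
- have -> : i = lpos j by apply: val_inj.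
  have -> : a = ordS (lpos j).
    by apply: val_inj; exact: etrans ha (esym (val_ordS_lpos j)).
  by rewrite /adj_tperm tpermL tpermR eq_sym.
- have -> : a = lpos j by apply: val_inj.
  have -> : i = ordS (lpos j).
    by apply: val_inj; exact: etrans hi (esym (val_ordS_lpos j)).
  by rewrite /adj_tperm tpermL tpermR.
Qed.

Lemma spec_swap j eta i : eta (lpos j) != eta (ordS (lpos j)) ->
  spec (swap j eta) i = spec eta (adj_tperm j i).
Proof. by move=> ne; rewrite /spec leg'_swap // swapE. Qed.

(** Of two adjacent equal entries, the right one also counts the left one in its
    leg. *)
Lemma spec_eq_pair j eta : eta (lpos j) = eta (ordS (lpos j)) ->
  spec eta (lpos j) = t * spec eta (ordS (lpos j)).
Proof.
move=> e; rewrite /spec -e.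
have -> : leg' eta (ordS (lpos j)) = (leg' eta (lpos j)).+1.
  rewrite !leg'E; apply: etrans (addn1 _).
  have <- : (\sum_(a < n.+1) (a == lpos j) = 1)%N.
    by rewrite (bigD1 (lpos j)) //= eqxx big1 // => a /negPf ->.
  rewrite -big_split; apply: eq_bigr => a _; rewrite -e.
  have hr := val_ordS_lpos j.
  have -> : (a == lpos j) = (a == j :> nat) by [].
  rewrite [(a < ordS _)%N](_ : _ = (a < j.+1)%N); last by rewrite -hr.
  rewrite ltnS leq_eqVlt /=.
  case: ltngtP => /= [_|_|ea]; rewrite ?addn0 //.
  have -> : a = lpos j by apply: val_inj.
  by rewrite leqnn ltnn.
by rewrite exprS invfM mulrCA [t * _]mulrA mulfV ?t_neq0 // mul1r.
Qed.

(** By [Hecke_interp], H_j p at the spectral vector of lam combines the values of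
    p at those of lam and of s_j lam; if the two entries are equal, the second
    term is absent. *)
Lemma Hecke_spec_neq0 j (p : {mpoly Qqt[n.+1]}) lam :
  (Hecke t j p).@[spec lam] != 0 ->
  exists b : bool, p.@[spec (if b then swap j lam else lam)] != 0.
Proof.
move=> h; have := Hecke_interp t j p (spec lam).
set x := spec lam (lpos j); set y := spec lam (ordS (lpos j)).
case: (eqVneq (lam (lpos j)) (lam (ordS (lpos j)))) => [e|ne].
  have xy : x = t * y by apply: spec_eq_pair.
  rewrite xy subrr mul0r add0r => e2.
  exists false; apply: contra_neq h => p0; move: e2; rewrite p0 mulr0 => /eqP.
  rewrite mulf_eq0 => /orP[|/eqP //].
  rewrite -{2}[y]mul1r -mulrBl mulf_eq0 subr_eq0 (negPf t_neq1).
  by rewrite (negPf (spec_neq0 _ _)).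
have xy : x - y != 0 by rewrite subr_eq0; apply: contra_neq ne; apply: spec_inj.
case: (eqVneq p.@[spec lam] 0) => [-> e2|p0 _]; last by exists false.
exists true; apply: contra_neq h => p0.
rewrite [X in _ * X + _](_ : _ = 0) in e2; last first.
  by rewrite -p0; apply: meval_eq => i; rewrite spec_swap.
by move/eqP: e2; rewrite !mulr0 addr0 mulf_eq0 (negPf xy) => /eqP.
Qed.

(** The predicate b records at which factors the swap was used. The composition
    is recovered from any J that agrees with b on the word, so that the records
    of the two words in [D_set] can be merged into one set. *)
Lemma foldr_Hecke_spec_neq0 js (p : {mpoly Qqt[n.+1]}) lam : uniq js ->
  (foldr (Hecke t (n := n)) p js).@[spec lam] != 0 ->
  exists mu (b : pred 'I_n.+1.-1), p.@[spec mu] != 0 /\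
    forall J : {set 'I_n.+1.-1}, {in js, forall j, (j \in J) = b j} ->
      lam = foldr (swap_if J) mu js.
Proof.
elim: js lam => [|j js IH] lam /=; first by move=> _ h; exists lam, pred0.
case/andP => jjs ujs /Hecke_spec_neq0 [b0 /(IH _ ujs)[mu [b [hmu hJ]]]].
exists mu, (fun a => if a == j then b0 else b a); split=> // J hb.
rewrite -(hJ J).
  rewrite /swap_if hb ?mem_head // eqxx.
  by case: b0 {hJ hb} => //; rewrite swapK.
move=> a ha; rewrite hb ?in_cons ?ha ?orbT //.
by case: eqP => // e; move: jjs; rewrite -e ha.
Qed.

Lemma val_ordS (i : 'I_n.+1) : ordS i = (if i == n :> nat then 0 else i.+1) :> nat.
Proof.
rewrite /=; case: eqP => [->|/eqP ne]; first by rewrite modnn.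
by rewrite modn_small // ltn_neqAle eqSS ne; apply: ltn_ord.
Qed.

Lemma PhiE eta i : Phi eta i = (eta (ordS i) + (i == n :> nat))%N.
Proof. by rewrite mnmE eqSS. Qed.

Lemma mdeg_Phi eta : mdeg (Phi eta) = (mdeg eta).+1.
Proof.
rewrite !mdegE [in RHS](reindex_inj (@ordS_inj n.+1)); apply: etrans (addn1 _).
have <- : (\sum_(i < n.+1) (i == n :> nat) = 1)%N.
  rewrite (bigD1 ord_max) //= eqxx big1 // => i.
  by rewrite -val_eqE /= => /negPf ->.
by rewrite -big_split; apply: eq_bigr => i _; rewrite PhiE.
Qed.

(** Moving the first entry past the others exchanges weak and strict comparisons
    with it, and increasing it by one exchanges them back. *)
Lemma leg'_Phi eta i : leg' (Phi eta) i = leg' eta (ordS i).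
Proof.
rewrite !leg'E [RHS](reindex_inj (@ordS_inj n.+1)); apply: eq_bigr => a _.
rewrite !PhiE; have := val_ordS a; have := val_ordS i.
move: (eta (ordS i)) (eta (ordS a)) (nat_of_ord (ordS i)) (nat_of_ord (ordS a)).
have := ltn_ord i; have := ltn_ord a.
move: (nat_of_ord i) (nat_of_ord a) => i' a' ha hi ei ea si sa -> ->.
congr nat_of_bool; case_ifs.
Qed.

Lemma spec_Phi eta i :
  spec (Phi eta) i = (if i == ord_max then q else 1) * spec eta (ordS i).
Proof.
rewrite /spec leg'_Phi PhiE -val_eqE /=; case: eqP => _.
  by rewrite addn1 exprS mulrA.
by rewrite addn0 mul1r.
Qed.

Lemma spec_last0 eta : eta ord_max = 0%N -> spec eta ord_max = t ^- n.
Proof.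
move=> e; rewrite /spec e expr0 mul1r leg'E big_ord_recr /= e !ltnn addn0.
congr (t ^- _); rewrite -[RHS]card_ord -sum1_card; apply: eq_bigr => a _.
by rewrite ltn_ord.
Qed.

Lemma Phi_surj lam : lam ord_max != 0%N -> exists mu, lam = Phi mu.
Proof.
move=> h; exists [multinom (lam (ord_pred i) - (i == ord0))%N | i < n.+1].
apply/mnmP => i; rewrite PhiE mnmE ordSK.
have -> : (ordS i == ord0) = (i == n :> nat).
  apply/eqP/eqP => [/(congr1 (@nat_of_ord _))|e].
    by rewrite val_ordS; case: eqP.
  by apply: val_inj; apply: etrans (val_ordS i) _; rewrite e eqxx.
case: eqP => [e|_]; last by rewrite subn0 addn0.
have -> : i = ord_max by apply: val_inj.
by rewrite subnK // lt0n.
Qed.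

(** The substitution in [Phi_poly] sends the spectral vector of Phi mu to that of
    mu, and the linear factor removes every lam that is not of the form Phi mu. *)
Lemma Phi_poly_spec_neq0 (p : {mpoly Qqt[n.+1]}) lam :
  (Phi_poly q t p).@[spec lam] != 0 ->
  exists2 mu, lam = Phi mu & p.@[spec mu] != 0.
Proof.
rewrite Phi_poly_meval; case: (eqVneq (lam ord_max) 0%N) => [e|].
  by rewrite spec_last0 // subrr mul0r eqxx.
move=> /Phi_surj [mu ->]; rewrite mulf_eq0 negb_or => /andP[_ h].
exists mu; first by [].
rewrite (meval_eq (v2 := spec mu)) // in h => i.
rewrite spec_Phi ord_predK.
have -> : (ord_pred i == ord_max) = (i == ord0).
  rewrite -(inj_eq (@ordS_inj n.+1)) ord_predK; congr (_ == _).
  by apply: val_inj; rewrite /= modnn.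
case: eqP => _; last by rewrite !mul1r.
by rewrite mulrA mulVf ?q_neq0 // mul1r.
Qed.

(** Each factor of R_k matches a factor of [D_set]: a Hecke operator allows the
    swap to be applied or not, and [Phi_poly] forces [Phi]. *)
Lemma raising_spec_neq0 k (p : {mpoly Qqt[n.+1]}) lam :
  (raising q t k p).@[spec lam] != 0 ->
  exists (J : {set 'I_n.+1.-1}) mu, lam = D_set k J mu /\ p.@[spec mu] != 0.
Proof.
have hu (P : pred 'I_n.+1.-1) : uniq (filter P (enum 'I_n.+1.-1)).
  by rewrite filter_uniq ?enum_uniq.
case/(foldr_Hecke_spec_neq0 (hu _)) => mu1 [b1 [/Phi_poly_spec_neq0 [mu2 e2]]].
case/(foldr_Hecke_spec_neq0 (hu _)) => mu3 [b3 [h3 e3]] e1.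
pose J := [set j : 'I_n.+1.-1 | if (j < k)%N then b3 j else b1 j].
exists J, mu3; split=> //; rewrite /D_set -(e3 J) -?e2 -?(e1 J) //.
  by move=> j; rewrite mem_filter inE leqNgt => /andP[/negPf ->].
by move=> j; rewrite mem_filter inE => /andP[->].
Qed.

Lemma mdeg_foldr_swap (J : {set 'I_n.+1.-1}) js mu :
  mdeg (foldr (swap_if J) mu js) = mdeg mu.
Proof. by elim: js => //= j js <-; rewrite /swap_if; case: ifP; rewrite ?mdeg_swap. Qed.

Lemma mdeg_D_set k (J : {set 'I_n.+1.-1}) mu : mdeg (D_set k J mu) = (mdeg mu).+1.
Proof. by rewrite /D_set !mdeg_foldr_swap mdeg_Phi mdeg_foldr_swap. Qed.

Lemma mem_D k lam nu : reflect (exists J, nu = D_set k J lam) (nu \in D k lam).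
Proof.
rewrite mem_undup; apply: (iffP mapP) => [[J _ ->]|[J ->]]; exists J => //.
exact: mem_enum.
Qed.

(** The two implications of [preceq'], rewritten as an inequality which is strict
    for the entries that move right; this form composes. *)
Lemma preceqP eta lam : reflect
  (exists s : 'S_n.+1, forall i,
     (eta i <= lam (s i))%N /\ ((i < s i)%N -> (eta i < lam (s i))%N))
  (preceq' eta lam).
Proof.
apply: (iffP existsP) => -[s hs]; exists s.
  move=> i; have /forallP /(_ i) /andP[/implyP h1 /implyP h2] := hs.
  case: (leqP (s i) i) => [/h2 //|/h1 h]; split=> //; exact: ltnW.
apply/forallP => i; have [h1 h2] := hs i.
by rewrite h1 implybT andbT; apply/implyP.
Qed.

Lemma preceq_refl eta : preceq' eta eta.
Proof. by apply/preceqP; exists 1%g => i; rewrite perm1 ltnn. Qed.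

(** An entry that moves right under the composite moves right under one of the
    two permutations. *)
Lemma preceq_trans eta mu lam : preceq' eta mu -> preceq' mu lam -> preceq' eta lam.
Proof.
move=> /preceqP[s hs] /preceqP[s' hs']; apply/preceqP; exists (s * s')%g => i.
rewrite permM; have [h1 h2] := hs i; have [h3 h4] := hs' (s i).
split; first exact: leq_trans h3.
move=> lt; case: (ltnP i (s i)) => [/h2|le]; first by move=> h; apply: leq_trans h3.
by apply: leq_ltn_trans h1 _; apply: h4; apply: leq_ltn_trans lt.
Qed.

(** The swaps s_(k-1), ..., s_m carry entries leftwards to position m; each entry
    that they pass moves one place to the right, into a position in m + 1, ..., k.
    Nothing else moves. No entry moves right by more than one place, which [Phi]
    will undo. *)
Lemma below_shift (J : {set 'I_n.+1.-1}) (k m : nat) js mu :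
  (m <= k)%N -> map val js = iota m (k - m) ->
  exists s : 'S_n.+1, forall i, [/\ mu i = foldr (swap_if J) mu js (s i),
    (s i <= m)%N || (k < s i)%N -> (s i <= i)%N & (s i <= i.+1)%N].
Proof.
elim: js m => [|j js IH] m mk.
  move=> _; exists 1%g => i; rewrite perm1; split=> //; lia.
case e : (k - m)%N => [|l] //= [hj hjs].
have [//||s hs] := IH m.+1; first lia.
  by rewrite hjs; congr iota; lia.
rewrite [swap_if _ _ _]/swap_if; case: ifP => _.
  exists (s * adj_tperm j)%g => i; rewrite permM swapE.
  have -> : adj_tperm j (adj_tperm j (s i)) = s i by rewrite /adj_tperm tpermK.
  have [h1 h2 h3] := hs i; rewrite !val_adj_tperm hj; split=> //; move: h2 h3; case_ifs.
exists s => i; have [h1 h2 h3] := hs i; split=> //; lia.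
Qed.

(** After [Phi], the entries before the last position and from k on lie strictly to
    the left of where they started, so that one move to the right does no
    harm, and the entry in the last position has been increased. The swaps
    s_(n-1), ..., s_m carry it, or an entry that replaced it, leftwards. *)
Lemma above_shift (J : {set 'I_n.+1.-1}) (k m : nat) js mu nu (s0 : 'S_n.+1) :
  (k <= m)%N -> (m <= n)%N -> map val js = iota m (n - m) ->
  (forall i, [/\ (mu i <= nu (s0 i))%N, (s0 i < k)%N -> (s0 i <= i)%N,
     (k <= s0 i < n)%N -> (s0 i < i)%N & (s0 i = n :> nat) -> (mu i < nu (s0 i))%N]) ->
  exists s : 'S_n.+1, forall i, let nu' := foldr (swap_if J) nu js in
   [/\ (mu i <= nu' (s i))%N, (s i < k)%N -> (s i <= i)%N,
     (k <= s i < m)%N -> (s i < i)%N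
     & (m <= s i)%N -> (i < s i)%N -> (mu i < nu' (s i))%N].
Proof.
move=> km mn hjs hs0; elim: js m km mn hjs => [|j js IH] m km mn.
  move=> hjs; exists s0 => i /=; have [h1 h2 h3 h4] := hs0 i.
  have mE : m = n by have := congr1 size hjs; rewrite /= size_iota; lia.
  split=> //; rewrite ?mE // => h5 _; apply: h4; have := ltn_ord (s0 i); lia.
case e : (n - m)%N => [|l] //= [hj hjs].
have [||//|s hs] := IH m.+1; try lia.
  by rewrite hjs; congr iota; lia.
rewrite [swap_if _ _ _]/swap_if; case: ifP => _.
  exists (s * adj_tperm j)%g => i; rewrite permM !swapE.
  have -> : adj_tperm j (adj_tperm j (s i)) = s i by rewrite /adj_tperm tpermK.
  have [h1 h2 h3 h4] := hs i; rewrite !val_adj_tperm hj; split=> //.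
  - by move: h2; case_ifs.
  - by move: h3; case_ifs.
  - by move=> le lt; apply: h4; move: h3 le lt; case_ifs.
exists s => i; have [h1 h2 h3 h4] := hs i; split=> //; first lia.
by move=> le lt; apply: h4 => //; lia.
Qed.

(** Only the entry increased by [Phi] can end up to the right of where it
    started: any other entry is moved right by at most one of the two words, by at
    most one place, and [Phi] moves it one place to the left. *)
Lemma preceq_D_set k (J : {set 'I_n.+1.-1}) mu : preceq' mu (D_set k J mu).
Proof.
have hk : (k <= n)%N by rewrite -ltnS.
have [//||s hs] := @below_shift J k 0 (below k) mu; first by rewrite subn0 val_below.
have ord_pred_inj : injective (@ord_pred n.+1) := can_inj (@ord_predK n.+1).
pose s0 := (s * perm ord_pred_inj)%g.
have [//|//||i|s' hs'] := @above_shift J k k (above k) mu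
    (Phi (foldr (swap_if J) mu (below k))) s0; first exact: val_above.
  rewrite /s0 permM permE PhiE ord_predK; have [<- h2 h3] := hs i.
  have hp : ord_pred (s i) = (if s i == 0 :> nat then n else (s i).-1) :> nat.
    case: (eqVneq (s i) ord0) => [->|nz]; first by rewrite val_ord_pred0.
    by rewrite val_ord_predS // -[s i == 0 :> nat]/(s i == ord0) (negPf nz).
  rewrite hp; have := ltn_ord (s i); move: h2 h3 hp.
  by move: (nat_of_ord (s i)) => a h2 h3 hp ha; split; move: h2 h3 ha; case_ifs.
apply/preceqP; exists s' => i; have [h1 h2 h3 h4] := hs' i; split=> // lt.
apply: h4 => //; lia.
Qed.

End Compositions.

(** * Interpolation Macdonald polynomials *)

Section Interpolation.
Variables (n d : nat) (o : option 'X_{1..n}).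
Hypothesis ho : forall eta, o = Some eta -> mdeg eta = d.
Local Notation B := 'X_{1..n < d.+1}.
Local Notation M := (map_mx (@tofrac _) (interp_mx d o)).

(** The matrix sends the coefficients of a polynomial to its (rescaled)
    interpolation conditions. *)
Lemma interp_mx_mul (c : 'cV[Qqt]_#|{: B}|) (mu : B) :
  (M *m c) (enum_rank mu) 0
  = interp_scale d o mu
    * interp_functional (@spec n) o mu (\sum_(m : B) c (enum_rank m) 0 *: 'X_[m]).
Proof.
rewrite interp_functional_sum mulr_sumr mxE.
rewrite (reindex enum_rank) /=; last by apply: onW_bij; apply: enum_rank_bij.
apply: eq_bigr => nu _; rewrite !mxE !enum_rankK mulrCA mulrC.
by rewrite interp_entryE // -ltnS bmdeg.
Qed.

Lemma interp_scale_neq0 (mu : 'X_{1..n}) : interp_scale d o mu != 0.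
Proof.
by rewrite /interp_scale; case: ifP => _; [apply: oner_neq0 | apply: expf_neq0 t_neq0].
Qed.

Lemma interp_inj (p : {mpoly Qqt[n]}) : deg_le d p ->
  (forall mu, (mdeg mu <= d)%N -> interp_functional (@spec n) o mu p = 0) -> p = 0.
Proof.
move=> hp h0; pose c : 'cV[Qqt]_#|{: B}| := \col_b p@_(enum_val b : B).
have pE : p = \sum_(m : B) c (enum_rank m) 0 *: 'X_[m].
  by rewrite {1}(mpolywE hp); apply: eq_bigr => m _; rewrite mxE enum_rankK.
have c0 : c = 0.
  rewrite -(mulKmx (interp_mx_unit ho) c) [M *m c](_ : _ = 0) ?mulmx0 //.
  apply/colP => a; rewrite -(enum_valK a) interp_mx_mul -pE h0.
    by rewrite mulr0 mxE.
  by rewrite -ltnS bmdeg.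
by rewrite pE big1 // => m _; rewrite c0 mxE scale0r.
Qed.

Lemma interp_ex (g : 'X_{1..n} -> Qqt) : exists2 p : {mpoly Qqt[n]}, deg_le d p &
  forall mu, (mdeg mu <= d)%N -> interp_functional (@spec n) o mu p = g mu.
Proof.
pose r : 'cV[Qqt]_#|{: B}| :=
  \col_a (interp_scale d o (enum_val a : B) * g (enum_val a : B)).
pose c := invmx M *m r.
exists (\sum_(m : B) c (enum_rank m) 0 *: 'X_[m]).
  apply: deg_le_sum => m _; apply: deg_leZ.
  by rewrite /deg_le msizeX; apply: bmdeg.
move=> mu; rewrite -ltnS => hmu.
have := interp_mx_mul c (BMultinom hmu).
rewrite mulKVmx ?interp_mx_unit // mxE enum_rankK /=.
by move/(mulfI (interp_scale_neq0 _)).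
Qed.

End Interpolation.

Section Vanishing.
Variable n : nat.
Implicit Types (p : {mpoly Qqt[n]}) (eta mu : 'X_{1..n}).

Lemma unisolvence d p : deg_le d p ->
  (forall mu, (mdeg mu <= d)%N -> p.@[spec mu] = 0) -> p = 0.
Proof. by move=> hp h0; apply: (@interp_inj n d None). Qed.

(** Q(q,t) is infinite; more concretely, the spectral vectors already separate
    polynomials. *)
Lemma meval_all0 p : (forall v, p.@[v] = 0) -> p = 0.
Proof. by move=> h; apply: (@unisolvence (msize p)); first exact: leqnSn. Qed.

Lemma EstarP eta : is_interp_macdonald eta (Estar eta).
Proof.
apply: epsilon_spec.
have [|p hp h] := @interp_ex n (mdeg eta) (Some eta) _ (fun mu => (mu == eta)%:R).
  by move=> ? [->].
exists p; split=> // [mu /eqP ne le|].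
  by have := h _ le; rewrite /interp_functional (inj_eq Some_inj) eq_sym (negPf ne).
by have := h eta (leqnn _); rewrite /interp_functional !eqxx.
Qed.

Lemma deg_le_Estar eta : deg_le (mdeg eta) (Estar eta).
Proof. by case: (EstarP eta). Qed.

Lemma Estar0 eta mu :
  mu <> eta -> (mdeg mu <= mdeg eta)%N -> (Estar eta).@[spec mu] = 0.
Proof. by case: (EstarP eta) => _ h _; apply: h. Qed.

(** Otherwise E_eta would vanish at all mubar with |mu| <= |eta|. *)
Lemma Estar_self_neq0 eta : (Estar eta).@[spec eta] != 0.
Proof.
apply/eqP => e; have [_ _ h1] := EstarP eta.
have E0 : Estar eta = 0.
  apply: unisolvence (deg_le_Estar eta) _ => mu le.
  by case: (eqVneq mu eta) => [->//|/eqP ne]; apply: Estar0.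
by move/eqP: h1; rewrite E0 mcoeff0 eq_sym oner_eq0.
Qed.

(** Substituting z_k = 0 in p gives zero, and it changes p by a multiple of z_k. *)
Lemma dvd_X p (k : 'I_n) : (forall v : 'I_n -> Qqt, v k = 0 -> p.@[v] = 0) ->
  exists r, p = 'X_k * r.
Proof.
move=> h; pose lq := [tuple (if i == k then 0 else 'X_i : {mpoly Qqt[n]}) | i < n].
have [i|r] := @dvd_sub_comp _ n 'X_k lq _ p.
  rewrite tnth_mktuple; case: eqP => [->|_]; first by exists 1; rewrite subr0 mulr1.
  by exists 0; rewrite subrr mulr0.
rewrite [p \mPo lq](_ : _ = 0) ?subr0; first by exists r.
apply: meval_all0 => v; rewrite comp_mpoly_meval; apply: h.
by rewrite tnth_mktuple eqxx meval0.
Qed.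

End Vanishing.

Lemma meval_lincomb (F : fieldType) n (I : Type) (s : seq I) (c : I -> F)
    (p : I -> {mpoly F[n]}) v :
  (\sum_(a <- s) c a *: p a).@[v] = \sum_(a <- s) c a * (p a).@[v].
Proof. by rewrite raddf_sum; apply: eq_bigr => a _; apply: mevalZ. Qed.

(** * Eigenvalue equation, Pieri formula and vanishing *)

Section PieriFormula.
Variable n : nat.
Implicit Types (eta lam mu nu : 'X_{1..n.+1}).

(** A nonzero value would come from a composition of modulus |mu| - 1, where E_lam
    vanishes. *)
Lemma raising_Estar0 k lam mu : (mdeg mu <= mdeg lam)%N ->
  (raising q t k (Estar lam)).@[spec mu] = 0.
Proof.
move=> le; apply/eqP/negPn/negP => /raising_spec_neq0 [J [mu' [e]]].
have hd : (mdeg mu' < mdeg lam)%N by rewrite -(mdeg_D_set k J) -e.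
by rewrite Estar0 ?eqxx ?(ltnW hd) // => e'; rewrite e' ltnn in hd.
Qed.

(** The eigenvalue equation of the Cherednik operator: the quotient of
    R_k E_lam + E_lam by z_k is Xi_k E_lam, and by [raising_Estar0] it has the values
    of E_lam / lambar_k at the nodes that determine it. *)
Lemma raising_Estar k lam :
  raising q t k (Estar lam) = ((spec lam k)^-1 *: 'X_k - 1) * Estar lam.
Proof.
have [v vk|r hr] := @dvd_X n.+1 (raising q t k (Estar lam) + Estar lam) k.
  by rewrite mevalD raising_at0 ?t_neq0 // addNr.
have dr : deg_le (mdeg lam) r.
  apply: (@deg_le_divr _ _ _ 'X_k); first by rewrite msizeX mdeg1.
  rewrite -hr; apply: deg_leD; first exact: deg_le_raising (deg_le_Estar _).
  exact: deg_le_leq (leqnSn _) (deg_le_Estar _).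
have rE : r = (spec lam k)^-1 *: Estar lam.
  apply/eqP; rewrite -subr_eq0; apply/eqP.
  apply: (@unisolvence _ (mdeg lam)).
    by apply: deg_leB => //; apply: deg_leZ; apply: deg_le_Estar.
  move=> mu le; have := congr1 (meval (spec mu)) hr.
  rewrite mevalD raising_Estar0 // add0r mevalM mevalXU mevalB mevalZ.
  case: (eqVneq mu lam) => [->|/eqP ne].
    by move=> ->; rewrite mulKf ?subrr ?spec_neq0.
  rewrite Estar0 // mulr0 subr0 => /esym/eqP.
  by rewrite mulf_eq0 (negPf (spec_neq0 _ _)) => /eqP.
apply: (addIr (Estar lam)); rewrite hr rE mulrBl mul1r subrK.
by rewrite -scalerAr -scalerAl.
Qed.

Lemma raising_Estar_meval k lam mu :
  (raising q t k (Estar lam)).@[spec mu]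
  = (spec mu k * (spec lam k)^-1 - 1) * (Estar lam).@[spec mu].
Proof.
rewrite raising_Estar mevalM mevalB mevalZ mevalXU meval1.
by rewrite [_^-1 * _]mulrC.
Qed.

(** Both sides have degree at most |lam| + 1, so it suffices to compare values. At
    a mu in [D k lam] all terms but one vanish; at any other mu of modulus at most
    |lam| + 1 both sides vanish, by [raising_spec_neq0]. *)
Lemma Pieri_Estar k lam :
  raising q t k (Estar lam)
  = \sum_(nu <- D k lam)
      ((spec nu k * (spec lam k)^-1 - 1) * (Estar lam).@[spec nu]
        / (Estar nu).@[spec nu]) *: Estar nu.
Proof.
apply/eqP; rewrite -subr_eq0; apply/eqP.
have mdegD nu : nu \in D k lam -> mdeg nu = (mdeg lam).+1.
  by case/mem_D => J ->; rewrite mdeg_D_set.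
apply: (@unisolvence _ (mdeg lam).+1).
  apply: deg_leB; first exact: deg_le_raising (deg_le_Estar _).
  rewrite big_seq; apply: deg_le_sum => nu /mdegD <-.
  by apply: deg_leZ; apply: deg_le_Estar.
move=> mu le; rewrite mevalB meval_lincomb.
have uD : uniq (D k lam) by apply: undup_uniq.
case: (boolP (mu \in D k lam)) => [muD|muD].
  rewrite (bigD1_seq mu) //= big1_seq ?addr0.
    by rewrite divfK ?Estar_self_neq0 // raising_Estar_meval subrr.
  move=> nu /andP[/eqP ne nuD].
  by rewrite (@Estar0 _ nu mu) ?mulr0 ?(mdegD _ nuD) // => e; apply: ne.
rewrite big1_seq ?subr0.
  apply/eqP/negPn/negP => /raising_spec_neq0 [J [mu' [e h]]].
  case: (eqVneq mu' lam) => [e'|/eqP ne].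
    by case/mem_D: muD; exists J; rewrite e e'.
  move: h; rewrite Estar0 ?eqxx //.
  by move: le; rewrite e mdeg_D_set.
move=> nu /andP[_ nuD].
by rewrite (@Estar0 _ nu mu) ?mulr0 ?(mdegD _ nuD) // => e; rewrite e nuD in muD.
Qed.

(** The extra vanishing property of interpolation Macdonald polynomials. If
    lambar and nubar differ in coordinate k, the factor in [raising_Estar_meval] is
    nonzero, so a value of E_nu at lambar comes from values at smaller
    compositions, and [preceq_D_set] leads back up to lam. *)
Lemma Estar_vanish nu lam : (Estar nu).@[spec lam] != 0 -> preceq' nu lam.
Proof.
have [m le] := ubnP (mdeg lam); elim: m lam le => // m IH lam le h.
case: (eqVneq lam nu) => [->|ne]; first exact: preceq_refl.
have [k hk] : exists k, lam k != nu k.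
  apply/existsP; apply: contraNT ne; rewrite negb_exists => /forallP hk.
  by apply/eqP/mnmP => k; apply/eqP/negPn.
have /raising_spec_neq0 [J [mu [e hmu]]] : (raising q t k (Estar nu)).@[spec lam] != 0.
  rewrite raising_Estar_meval; apply: mulf_neq0 h.
  rewrite subr_eq0; apply: contra_neq hk => e; apply: spec_inj.
  by rewrite -[LHS](divfK (spec_neq0 nu k)) e mul1r.
apply: preceq_trans (IH mu _ hmu) _; last by rewrite e; apply: preceq_D_set.
by move: le; rewrite e mdeg_D_set.
Qed.

End PieriFormula.

(* hden: the denominator in the sum is nonzero; the choice of k alone does not
   ensure this, for instance when lami = (2,0) and lamj = (2,2). *)
Theorem corollary7 (n : nat) (hn : (0 < n)%N) (eta : 'X_{1..n}) (i j : nat)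
  (hij : (i < j - 1)%N) (lami lamj : 'X_{1..n})
  (hi : mdeg lami = (mdeg eta + i)%N) (hj : mdeg lamj = (mdeg eta + j)%N)
  (k : 'I_n) (hk : leftmost_freq_diff lami lamj k)
  (hden : spec lamj k * (spec lami k)^-1 - 1 <> 0) :
  qtbinom lami lamj
    = (Estar lami).@[spec lamj] / (Estar lamj).@[spec lamj]
  /\
  (Estar lami).@[spec lamj] / (Estar lamj).@[spec lamj]
    = \sum_(nu <- D k lami | preceq' nu lamj)
        ((spec nu k * (spec lami k)^-1 - 1)
           / (spec lamj k * (spec lami k)^-1 - 1))
        * ((Estar lami).@[spec nu] / (Estar nu).@[spec nu])
        * ((Estar nu).@[spec lamj] / (Estar lamj).@[spec lamj]).
Proof.
split=> //.
case: n hn eta lami lamj hi hj k hk hden => // n _ _ lami lamj _ _ k _ /eqP hden.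
have := congr1 (meval (spec lamj)) (Pieri_Estar k lami).
rewrite raising_Estar_meval meval_lincomb => /(canRL (mulKf hden)) ->.
rewrite mulr_sumr mulr_suml [RHS]big_mkcond; apply: eq_bigr => nu _ /=.
case: (boolP (preceq' nu lamj)) => [_|h].
  have regroup (F : fieldType) (a b c d e f : F) :
    d * (a * b * c * e) * f = a * d * (b * c) * (e * f) by ring.
  exact: regroup.
suff -> : (Estar nu).@[spec lamj] = 0 by rewrite !mulr0 mul0r.
by apply: contraNeq h; apply: Estar_vanish.
Qed.
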